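(* Let $T$ be a finite tree with at least two vertices. For every configuration $C$ on $T$ and every vertex $r\in V(T)$, a configuration stacked at $r$ is reachable from $C$ if and only if $S_r(C)>0$. Consequently $C$ is nonstackable if and only if $S_v(C)\le 0$ for every $v\in V(T)$.
   Context: Graphs are finite, simple and undirected; a tree is a nonempty connected acyclic graph; $\mathbb N$ includes $0$; $u\sim v$ denotes adjacency. Pebbling. A configuration on $T$ is a function $C:V(T)\to\mathbb N$; its support is $\{v:C(v)>0\}$. A move $u\to v$ is legal when $u\sim v$ and $C(u)\ge 2$; it replaces $C(u)$ by $C(u)-2$ and $C(v)$ by $C(v)+1$. A configuration is reachable from $C$ if it is obtained by a finite (possibly empty) sequence of legal moves. A configuration is stacked at $r$ when its support is exactly $\{r\}$ (so the zero configuration is not stacked). $C$ is stackable if, for some vertex $r$, a configuration stacked at $r$ is reachable from $C$; otherwise it is nonstackable. Messages and scores. For adjacent $v,p$ let $B_{v\mid p}$ be the component containing $v$ after deleting the edge $vp$. It is occupied (with respect to $C$) if $C$ is not identically zero on it, and empty otherwise. Define $F:\mathbb Z\to\mathbb Z$ by $F(x)=2x-3$ for $x\le1$; $F(x)=x/2$ for even $x\ge2$; $F(x)=(x-3)/2$ for odd $x\ge3$. For an occupied branch $B_{v\mid p}$ define recursively the integer message $$d_{v\to p}=F\Bigl(C(v)+\sum_{\substack{u\sim v,\ u\ne p\\ B_{u\mid v}\text{ occupied}}}d_{u\to v}\Bigr).$$ Put $\bar d_{v\to p}=d_{v\to p}$ if $B_{v\mid p}$ is occupied and $\bar d_{v\to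 p}=0$ if it is empty. The score at $r$ is $$S_r(C)=C(r)+\sum_{u\sim r}\bar d_{u\to r}.$$ *)

(* Defs.v *)
From HB Require Import structures.
From Stdlib Require Import Relation_Operators.
From mathcomp Require Import all_boot all_order all_algebra.

Set Implicit Arguments.
Unset Strict Implicit.
Unset Printing Implicit Defensive.

Import Order.TTheory GRing.Theory Num.Theory.

Section Trees.

Variables (T : finType) (e : rel T).

Definition connected_graph : Prop := forall x y, connect e x y.

(* A cyclic sequence of length at most 2 only retraces an edge. *)
Definition acyclic_graph : Prop :=
  forall c : seq T, 2 < size c -> ~~ (cycle e c && uniq c).

Definition is_tree : Prop :=
  [/\ symmetric e, irreflexive e, 0 < #|T|, connected_graph & acyclic_graph].

End Trees.

Section Pebbling.

Variables (T : finType) (e : rel T).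

Definition config := {ffun T -> nat}.

Definition legal_move (C : config) (u v : T) : bool := e u v && (2 <= C u).

(* Only used for u != v, so the order of the two tests is immaterial. *)
Definition do_move (C : config) (u v : T) : config :=
  [ffun x => if x == u then C u - 2 else if x == v then C v + 1 else C x].

Definition move_step (C C' : config) : Prop :=
  exists u v, legal_move C u v /\ C' = do_move C u v.

Definition reachable : config -> config -> Prop :=
  clos_refl_trans_1n config move_step.

Definition support (C : config) : {set T} := [set v | 0 < C v].

Definition stacked_at (C : config) (r : T) : Prop := support C = [set r].

Definition stackable_at (C : config) (r : T) : Prop :=
  exists2 C', reachable C C' & stacked_at C' r.

Definition stackable (C : config) : Prop := exists r, stackable_at C r.

Definition nonstackable (C : config) : Prop := ~ stackable C.

End Pebbling.

Section Scores.

Variables (T : finType) (e : rel T).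

Definition del_edge (v p : T) : rel T :=
  fun x y => e x y && ~~ [|| (x == v) && (y == p) | (x == p) && (y == v)].

Definition branch (v p : T) : {set T} := [set x | connect (del_edge v p) v x].

Definition occupied (C : config T) (v p : T) : bool :=
  [exists x in branch v p, C x != 0].

Local Open Scope ring_scope.

Definition F (x : int) : int :=
  if x <= 1 then 2 * x - 3
  else if (2 %| x)%Z then (x %/ 2)%Z
  else ((x - 3) %/ 2)%Z.

Variable C : config T.

(* The first argument bounds the recursion depth; for an edge v p of a tree,
   #|branch v p| levels suffice and the default 0 is never reached: messageE
   is the recursive definition of the messages. *)
Fixpoint message_rec (n : nat) (v p : T) : int :=
  if n is n'.+1 then
    F ((C v)%:Z
       + \sum_(u | [&& e u v, u != p & occupied C u v]) message_rec n' u v)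
  else 0.

Definition message (v p : T) : int := message_rec #|branch v p| v p.

Definition message_bar (v p : T) : int :=
  if occupied C v p then message v p else 0.

Definition score (r : T) : int :=
  (C r)%:Z + \sum_(u | e u r) message_bar u r.

Lemma branch_self v p : v \in branch v p.
Proof. by rewrite inE connect0. Qed.

Lemma branchN u v : is_tree e -> e u v -> v \notin branch u v.
Proof.
case=> se ie _ _ ac euv; rewrite inE; apply/negP => /connectP [s0 ps0 ls0].
case/shortenP: ps0 ls0 => s ps us _ ls.
have pe : path e u s by apply: sub_path ps => x y /andP [].
have := ac (u :: s); rewrite us /= rcons_path pe /= -ls se euv /=.
case: s ps us ls {pe} => [|x [|y s]] //=.
- by move=> _ _ eq; rewrite eq ie in euv.
- by move=> + _ eq; rewrite -eq /del_edge !eqxx /= andbF.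
- by move=> _ _ _ /(_ isT).
Qed.

Lemma branch_proper u v p :
  is_tree e -> e u v -> e v p -> u != p -> branch u v \proper branch v p.
Proof.
move=> ht euv evp up; have [se ie _ _ _] := ht.
have nv := branchN ht euv.
apply/properP; split; last by exists v; rewrite ?branch_self.
have vu : u != v by apply: contraTneq euv => ->; rewrite ie.
apply/subsetP => x; rewrite !inE => /connectP [s ps ->].
have vu' : connect (del_edge v p) v u.
  by apply: connect1; rewrite /del_edge se euv (negPf up) (negPf vu) /= !andbF.
suff gen y : path (del_edge u v) y s -> y \in branch u v ->
    connect (del_edge v p) v y -> connect (del_edge v p) v (last y s).
  exact: gen ps (branch_self u v) vu'.
elim: s y {ps} => [|z s IH] y //= /andP [eyz pz] yB cy.
have zB : z \in branch u v.
  by move: yB; rewrite !inE => h; apply: connect_trans h (connect1 eyz).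
apply: (IH _ pz zB); apply: (connect_trans cy); apply: connect1.
case/andP: eyz => eyz _; rewrite /del_edge eyz /=.
have /negPf -> : y != v by apply: contraNneq nv => eqv; rewrite -{1}eqv.
have /negPf -> : z != v by apply: contraNneq nv => eqv; rewrite -{1}eqv.
by rewrite andbF.
Qed.

Lemma message_recE n v p : is_tree e -> e v p ->
  (#|branch v p| <= n)%N -> message_rec n v p = message v p.
Proof.
move=> ht; rewrite /message.
suff H m : forall n v p, e v p -> (#|branch v p| <= n)%N ->
    (#|branch v p| <= m)%N -> message_rec n v p = message_rec m v p.
  by move=> evp hn; apply: H.
have pos w q : (#|branch w q| <= 0)%N = false.
  by apply/negbTE; rewrite -ltnNge; apply/card_gt0P; exists w; exact: branch_self.
elim: m => [|m IH] {n v p} [|n] v p evp; rewrite ?pos // => hn hm /=.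
congr (F (_ + _)); apply: eq_bigr => u.
case/and3P=> euv up _; have lt := proper_card (branch_proper ht euv evp up).
by apply: IH => //; rewrite -ltnS; exact: leq_trans lt _.
Qed.

Lemma messageE v p : is_tree e -> e v p ->
  message v p =
  F ((C v)%:Z + \sum_(u | [&& e u v, u != p & occupied C u v]) message u v).
Proof.
move=> ht evp; rewrite -(message_recE ht evp (leqnSn _)) /=.
congr (F (_ + _)); apply: eq_bigr => u /and3P [euv up _].
by rewrite (message_recE ht euv) // ltnW // proper_card // branch_proper.
Qed.

End Scores.

(* Main.v *)
Require Import Defs.
From mathcomp Require Import all_boot all_order all_algebra.
From mathcomp Require Import zify.
From Stdlib Require Import Relation_Operators.

Set Implicit Arguments.
Unset Strict Implicit.
Unset Printing Implicit Defensive.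

Import Order.TTheory GRing.Theory Num.Theory.

(** A run of moves is summarised by its flow: m u v is the number of moves made
    from u to v, and every vertex satisfies C' v + 2 out v = C v + in v.  Across
    an edge, the branch of v delivers to its neighbour p the net amount
    g = m v p - 2 m p v, possibly negative.

    Upper bound.  Suppose the branch of v ends up empty.  With a = m v p,
    b = m p v and y = C v + (net amounts from the other neighbours), balance at v
    reads b = 2 a - y, whence g = 2 y - 3 a.  If the branch was occupied, then
    a >= 1, because a move inside the branch never empties it; and a >= y / 2
    because b >= 0.  The best value is therefore 2 y - 3 max(1, ceil(y / 2)),
    which is exactly F y.  F is not monotone, so knowing only that the net amounts
    are at most the messages would not pass through the recursion.  The cure is a
    congruence: a net amount is congruent to the message modulo 3, and
    F (x + 3) >= F x.  Induction over branches (net_below_message) shows that each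
    net amount is the message minus a natural multiple of 3; summing at the
    target r gives C' r <= score r, so the score is positive
    (stackable_score_gt0).

    Attainment.  Conversely, using the optimal a and b on every edge that points
    to r gives a flow whose net amounts are the messages, which empties all other
    vertices and leaves score r pebbles at r (plan_balanced).  It remains to order
    its moves legally (flow_reachable).  The invariant is that every vertex other
    than r which holds a pebble or still awaits one has a move to its parent left.
    One performs any available planned move, but moves to the parent only once
    nothing else is planned at that vertex.  This keeps the invariant, since a
    vertex other than r must end empty.  It never blocks (flow_progress): if all
    vertices with planned moves held at most one pebble, then in >= out everywhere;
    climbing from a vertex with planned moves, the invariant makes pebbles still
    due at r, where in > out as r ends with a pebble; but the sums of in and of
    out agree. *)

(** * Branches of a tree *)

Section Branches.

Variables (T : finType) (e : rel T).
Hypothesis hT : is_tree e.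

Let e_sym : symmetric e. Proof. by case: hT. Qed.
Let e_irr : irreflexive e. Proof. by case: hT. Qed.

Lemma del_edgeC u v : del_edge e u v =2 del_edge e v u.
Proof. by move=> x y; rewrite /del_edge orbC. Qed.

Lemma del_edge_sym u v : symmetric (del_edge e u v).
Proof.
move=> x y; rewrite /del_edge e_sym; congr (_ && ~~ _).
by rewrite orbC [(x == v) && _]andbC [(x == u) && _]andbC.
Qed.

(** The edge deleted in forming the branch is its only way out. *)
Lemma branch_step v p x y :
  x \in branch e v p -> e x y -> (x, y) != (v, p) -> y \in branch e v p.
Proof.
rewrite xpair_eqE !inE => vx exy xy.
have [/andP [_ /eqP ->]|pv] := boolP ((x == p) && (y == v)).
  exact: connect0.
apply: connect_trans vx (connect1 _).
by rewrite /del_edge exy (negPf xy) (negPf pv).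
Qed.

Lemma branch_disj u v x :
  e u v -> x \in branch e u v -> (x \in branch e v u) = false.
Proof.
move=> euv; rewrite !inE (eq_connect (del_edgeC v u)) => ux.
apply/negP => vx; have := branchN hT euv; rewrite inE => /negP; apply.
by apply: connect_trans ux _; rewrite (sym_connect_sym (@del_edge_sym u v)).
Qed.

(** A simple path from v to x does not come back to v after its first step. *)
Lemma exists_branch v x : v != x -> exists2 u, e u v & x \in branch e u v.
Proof.
move=> vx; have [_ _ _ conn _] := hT.
have /connectP [s0 ps0 lx] := conn v x.
case/shortenP: ps0 lx => [[|u s]] /= ps us _ lx; first by rewrite lx eqxx in vx.
case/andP: ps => evu ps; exists u; first by rewrite e_sym.
case/andP: us => vs _; rewrite inE lx; apply/connectP; exists s => //.
have avoid w y : v \notin y :: s -> path e y s -> path (del_edge e w v) y s.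
  elim: s y {ps vs lx} => [|z s IH] y //=.
  rewrite !inE !negb_or => /and3P [vy vz vs] /andP [eyz ps].
  rewrite IH ?inE ?negb_or ?vz // /del_edge eyz ![_ == v]eq_sym.
  by rewrite (negPf vy) (negPf vz) andbF.
exact: avoid.
Qed.

Lemma occupiedP (C : config T) v p :
  reflect (exists2 x, x \in branch e v p & C x != 0) (occupied e C v p).
Proof. exact: exists_inP. Qed.

Lemma occupied_parent (C : config T) u v p :
  e u v -> e v p -> u != p -> occupied e C u v -> occupied e C v p.
Proof.
move=> euv evp up /occupiedP [x xB Cx]; apply/occupiedP; exists x => //.
exact: subsetP (proper_sub (branch_proper hT euv evp up)) x xB.
Qed.

Lemma occupied_self (C : config T) v p : C v != 0 -> occupied e C v p.
Proof. by move=> Cv; apply/occupiedP; exists v; rewrite ?branch_self. Qed.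

(** * Messages as optimal costs of clearing a branch *)

Local Open Scope ring_scope.

Lemma message_sumE (C : config T) v p :
  \sum_(u | [&& e u v, u != p & occupied e C u v]) message e C u v
  = \sum_(u | e u v && (u != p)) message_bar e C u v.
Proof.
rewrite [RHS](eq_bigr (fun u => if occupied e C u v then message e C u v else 0)) //.
by rewrite -big_mkcondr; apply: eq_bigl => u; rewrite andbA.
Qed.

(** The argument of F in the recursion: the net number of pebbles at v
    once the other branches at v have been cleared at best. *)
Definition weight (C : config T) (v p : T) : int :=
  (C v)%:Z + \sum_(u | e u v && (u != p)) message_bar e C u v.

Lemma message_barE (C : config T) v p :
  e v p -> message_bar e C v p = if occupied e C v p then F (weight C v p) else 0.
Proof. by move=> evp; rewrite /message_bar messageE // message_sumE. Qed.

Lemma weight_empty (C : config T) v p :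
  e v p -> ~~ occupied e C v p -> weight C v p = 0.
Proof.
move=> evp nocc; have -> : weight C v p = (C v)%:Z.
  rewrite /weight big1 ?addr0 // => u /andP [euv up].
  by rewrite /message_bar ifN //; apply: contra nocc; apply: occupied_parent.
by apply/eqP; apply: contraNT nocc => Cv; apply: occupied_self.
Qed.

(** The number max(1, ceil(x / 2)) of moves to p with which a vertex of weight x
    clears its occupied branch at least cost; p must supply the missing
    2 * exits x - x pebbles. *)
Definition exits (x : int) : nat := if x <= 2 then 1%N else uphalf `|x|%N.

Lemma exits_gt0 x : (0 < exits x)%N.
Proof. rewrite /exits; case: ifP; lia. Qed.

Lemma exits_ge x : x <= 2 * (exits x)%:Z.
Proof. rewrite /exits; case: ifP; lia. Qed.

Lemma exits_min x (a : nat) : (0 < a)%N -> x <= 2 * a%:Z -> (exits x <= a)%N.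
Proof. rewrite /exits; case: ifP; lia. Qed.

(** What p gains: exits x arrivals, minus two pebbles for each of the
    2 * exits x - x moves made towards the branch. *)
Lemma F_exits x : F x = 2 * x - 3 * (exits x)%:Z.
Proof. rewrite /F /exits; case: ifP; [|case: ifP]; case: ifP; lia. Qed.

Local Close Scope ring_scope.

(** * Flows *)

Implicit Types (m : T -> T -> nat) (C : config T).

Definition inflow m v := \sum_u m u v.
Definition outflow m v := \sum_u m v u.

Definition on_edges m := forall u v, 0 < m u v -> e u v.

Definition balanced m C C' :=
  forall v, C' v + 2 * outflow m v = C v + inflow m v.

Definition add_move m x y : T -> T -> nat :=
  fun a b => m a b + ((a == x) && (b == y)).

Lemma inflow_add m x y v : inflow (add_move m x y) v = inflow m v + (v == y).
Proof.
rewrite /inflow big_split /=; congr (_ + _).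
by rewrite (bigD1 x) //= eqxx big1 ?addn0 // => u /negPf ->.
Qed.

Lemma outflow_add m x y v : outflow (add_move m x y) v = outflow m v + (v == x).
Proof.
rewrite /outflow big_split /=; congr (_ + _).
by rewrite (bigD1 y) //= eqxx andbT big1 ?addn0 // => u /negPf ->; rewrite andbF.
Qed.

Lemma do_moveE C x y v : legal_move e C x y ->
  do_move C x y v + 2 * (v == x) = C v + (v == y).
Proof.
case/andP=> exy Cx; have xy : x != y by apply: contraTneq exy => ->; rewrite e_irr.
rewrite ffunE; case: (eqVneq v x) => [->|vx]; last first.
  by case: (eqVneq v y) => [->|vy]; rewrite addn0.
by rewrite (negPf xy) subnK ?addn0.
Qed.

(** Prepending a legal move to a flow; used both to read a flow off a run and to
    peel moves off a flow. *)
Lemma balanced_add m C C' x y : legal_move e C x y ->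
  balanced (add_move m x y) C C' <-> balanced m (do_move C x y) C'.
Proof.
by move=> xy; split=> bal v; have := bal v; have := do_moveE v xy;
  rewrite inflow_add outflow_add; lia.
Qed.

Lemma leq_inflow m u v : m u v <= inflow m v.
Proof. by rewrite /inflow (bigD1 u) //= leq_addr. Qed.

Lemma leq_outflow m v u : m v u <= outflow m v.
Proof. by rewrite /outflow (bigD1 u) //= leq_addr. Qed.

Lemma sum_inflow m : \sum_v inflow m v = \sum_v outflow m v.
Proof. exact: exchange_big. Qed.

(** A legal move uses two pebbles and leaves one where it lands, so it empties a
    branch only by landing outside it. *)
Lemma occupied_do_move C x y v p : legal_move e C x y -> (x, y) != (v, p) ->
  occupied e C v p -> occupied e (do_move C x y) v p.
Proof.
move=> lxy nvp /occupiedP [z zB Cz]; apply/occupiedP.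
have := fun v => do_moveE v lxy; case/andP: lxy => exy Cx moveE.
have yx : y != x by apply: contraTneq exy => ->; rewrite e_irr.
have [zx|zx] := eqVneq z x.
  exists y; first by apply: branch_step nvp; rewrite // -zx.
  by have := moveE y; rewrite eqxx (negPf yx); lia.
by exists z => //; have := moveE z; rewrite (negPf zx); lia.
Qed.

(** Besides the balance, the flow must remember that an occupied branch is
    emptied only through its own edge: this forces the a >= 1 in the optimisation
    behind F, and does not follow from the balance. *)
Lemma flow_of_reachable C C' : reachable e C C' ->
  exists m, [/\ on_edges m, balanced m C C' &
    forall v p, occupied e C v p -> m v p = 0 -> occupied e C' v p].
Proof.
elim=> [D|D D1 D' [x [y [lxy ->]]] _ [m [me bal occ]]].
  exists (fun _ _ => 0); split=> // v.
  by rewrite /outflow /inflow !big1.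
exists (add_move m x y); split; last 1 first.
- move=> v p oD /eqP; rewrite addn_eq0 eqb0 => /andP [/eqP mvp xy].
  apply: occ mvp; apply: occupied_do_move oD => //.
  by rewrite xpair_eqE ![_ == v]eq_sym [y == p]eq_sym.
- move=> u v; rewrite addn_gt0 => /orP [/me //|].
  by rewrite lt0b => /andP [/eqP -> /eqP ->]; case/andP: lxy.
- exact/balanced_add.
Qed.

Local Open Scope ring_scope.

Definition net m v p : int := (m v p)%:Z - 2 * (m p v)%:Z.

(** The form of the balance at v that involves only what each neighbour
    delivers. *)
Lemma balanced_net m C C' : on_edges m ->
  balanced m C C' <->
  (forall v, (C' v)%:Z = (C v)%:Z + \sum_(u | e u v) net m u v).
Proof.
move=> me; have netE v :
    \sum_(u | e u v) net m u v = (inflow m v)%:Z - 2 * (outflow m v)%:Z.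
  have -> : \sum_(u | e u v) net m u v = \sum_u net m u v.
    rewrite big_mkcond; apply: eq_bigr => u _; case: ifPn => // neuv.
    have := @me u v; have := @me v u; rewrite [e v u]e_sym (negPf neuv) /net.
    by case: (m u v) (m v u) => [|?] [|?] // H1 H2;
      [have := H1 isT | have := H2 isT | have := H1 isT].
  rewrite sumrB -mulr_sumr /inflow /outflow.
  by rewrite !(big_morph Posz PoszD (erefl (0%N : int))).
by split=> bal v; have := bal v; rewrite netE; lia.
Qed.

(** * Messages bound the flow that empties a branch *)

(** At most d and congruent to d modulo 3.  The congruence makes the comparison
    survive the non-monotone F: raising the argument of F by 3 raises exits by at
    most 2, hence does not lower F. *)
Definition below_mod3 (g d : int) := exists k : nat, d = g + 3 * k%:Z.

Lemma below_mod3_sum (P : pred T) (g d : T -> int) :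
  (forall u, P u -> below_mod3 (g u) (d u)) ->
  below_mod3 (\sum_(u | P u) g u) (\sum_(u | P u) d u).
Proof.
move=> H; apply: (big_ind2 (fun d g => below_mod3 g d)) H; first by exists 0%N.
by move=> x y x' y' [k ->] [k' ->]; exists (k + k')%N; lia.
Qed.

(** With a = m v p, b = m p v and y = 2 a - b = weight - 3 k, the net amount is
    2 y - 3 a, and the message is 2 (y + 3 k) - 3 exits (y + 3 k); the latter
    exits is at most a + 2 k by minimality. *)
Lemma net_below_message m C C' v p : on_edges m -> balanced m C C' ->
  (forall v p, occupied e C v p -> m v p = 0%N -> occupied e C' v p) ->
  e v p -> ~~ occupied e C' v p -> below_mod3 (net m v p) (message_bar e C v p).
Proof.
move=> me /(balanced_net _ _ me) bal occ.
have [n] := ubnP #|branch e v p|; elim: n v p => // n IH v p lt evp nocc'.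
have [k wE] : below_mod3 ((C v)%:Z + \sum_(u | e u v && (u != p)) net m u v)
                     (weight C v p).
  have [u /andP [euv up]|k dE] := @below_mod3_sum (fun u => e u v && (u != p))
      (fun u => net m u v) (fun u => message_bar e C u v).
    apply: IH => //; last by apply: contra nocc'; apply: occupied_parent.
    exact: leq_trans (proper_card (branch_proper hT euv evp up)) _.
  by exists k; rewrite /weight dE; lia.
have C'v : C' v = 0%N.
  by apply/eqP; apply: contraNT nocc' => ?; apply: occupied_self.
have := bal v; rewrite C'v (bigD1 p) 1?e_sym //= => balv.
set rest := \sum_(u | _) _ in wE balv.
have netvp : net m v p = (m v p)%:Z - 2 * (m p v)%:Z by [].
have netpv : net m p v = (m p v)%:Z - 2 * (m v p)%:Z by [].
rewrite message_barE //; case: ifPn => [oC|nC].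
  have mvp : (0 < m v p)%N.
    by rewrite lt0n; apply: contraNN nocc' => /eqP; apply: occ.
  have cle : (exits (weight C v p) <= m v p + 2 * k)%N.
    by apply: exits_min; lia.
  exists (m v p + 2 * k - exits (weight C v p))%N; rewrite F_exits; lia.
have := weight_empty evp nC; exists (m v p + 2 * k)%N; lia.
Qed.

Lemma stackable_score_gt0 C r : stackable_at e C r -> 0 < score e C r.
Proof.
case=> C' reachC' stacked; have [m [me bal occ]] := flow_of_reachable reachC'.
have supp x : (0 < C' x)%N = (x == r).
  by have /setP/(_ x) := stacked; rewrite !inE.
have [u|k scoreE] := @below_mod3_sum (fun u => e u r)
    (fun u => net m u r) (fun u => message_bar e C u r).
  move=> eur; apply: (net_below_message me bal occ eur).
  apply/occupiedP => -[x xB].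
  by rewrite -lt0n supp => /eqP xr; move: xB; rewrite xr (negPf (branchN hT eur)).
rewrite /score scoreE; have := supp r; rewrite eqxx.
by have /(balanced_net _ _ me)/(_ r) := bal; lia.
Qed.

Local Close Scope ring_scope.
(** * Realising the optimal flow towards a root *)

Section Rooted.

Variable r : T.

(** At r itself no neighbour qualifies, and the default makes parent r = r. *)
Definition parent v := odflt r [pick p | e v p && (r \in branch e p v)].

Lemma parentP v : v != r -> e v (parent v) && (r \in branch e (parent v) v).
Proof.
rewrite /parent; case: pickP => //= nop vr.
by have [p epv rp] := exists_branch vr; have := nop p; rewrite e_sym epv rp.
Qed.

(** The root lies beyond at most one neighbour of v, so every other neighbour is
    a child of v. *)
Lemma root_beyond u v p :
  e u v -> e v p -> r \in branch e p v -> u != p -> r \in branch e v u.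
Proof.
move=> euv evp rp up; apply: subsetP rp.
by apply/proper_sub/branch_proper => //; rewrite 1?e_sym 1?eq_sym.
Qed.

(** Branches grow strictly along a path to the root. *)
Lemma parent_climb (P : T -> Prop) :
  (forall v, v != r -> P v -> P (parent v)) -> forall v, P v -> P r.
Proof.
move=> climb v; have [n] := ubnP #|~: branch e v (parent v)|.
elim: n v => // n IH v lt; have [->//|vr] := eqVneq v r.
move=> /(climb _ vr); have /andP [evp rp] := parentP vr.
have [->//|pr] := eqVneq (parent v) r; apply: IH.
have /andP [epq rq] := parentP pr.
apply: leq_trans (_ : #|~: branch e v (parent v)| <= n) => //; apply: proper_card.
rewrite properC; apply: branch_proper => //; apply: contraTneq rq => <-.
by rewrite (branch_disj _ rp) // e_sym.
Qed.


(** Otherwise each vertex with planned moves holds at most one pebble and must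
    receive at least as many as it sends; climbing along the invariant, pebbles
    are due at r, where the inequality is strict, contradicting
    sum_inflow. *)
Lemma flow_progress m C C' :
  balanced m C C' -> 0 < C' r ->
  (forall v, v != r -> 0 < C v + inflow m v -> 0 < m v (parent v)) ->
  0 < \sum_v outflow m v -> exists2 v, 2 <= C v & 0 < outflow m v.
Proof.
move=> bal C'r drain out_gt0.
have [/existsP [v /andP [? ?]]|] :=
  boolP [exists v, (2 <= C v) && (0 < outflow m v)]; first by exists v.
move=> /existsPn stuck; exfalso.
have le_out_in v : outflow m v <= inflow m v.
  by have := bal v; have := stuck v; lia.
have [v0 out0] : exists v, 0 < outflow m v.
  move: out_gt0; rewrite lt0n sum_nat_eq0 => /forallPn [v].
  by rewrite -lt0n; exists v.
have in_r : 0 < inflow m r.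
  apply: (@parent_climb (fun v => 0 < inflow m v)) (leq_trans out0 (le_out_in v0)).
  move=> v vr inv; apply: leq_trans (leq_inflow m v _).
  by apply: drain; rewrite // addn_gt0 inv orbT.
have lt_r : outflow m r < inflow m r.
  by have := bal r; have := stuck r; lia.
have := sum_inflow m; rewrite (bigD1 r) //= [RHS](bigD1 r) //=.
suff : \sum_(v | v != r) outflow m v <= \sum_(v | v != r) inflow m v by lia.
exact: leq_sum.
Qed.

(** The hypothesis on parents says that no vertex spends its last move towards r
    while pebbles are present or due.  A balanced flow without it can be
    unrealisable: two adjacent vertices with one pebble each and one planned move
    each way are stuck. *)
Lemma flow_reachable m C C' :
  on_edges m -> balanced m C C' -> stacked_at C' r ->
  (forall v, v != r -> 0 < C v + inflow m v -> 0 < m v (parent v)) ->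
  reachable e C C'.
Proof.
move=> me bal stacked drain.
have supp x : (0 < C' x) = (x == r) by have /setP/(_ x) := stacked; rewrite !inE.
have [n] := ubnP (\sum_v outflow m v).
elim: n m C me bal drain => // n IH m C me bal drain lt.
have [tot0|tot_gt0] := posnP (\sum_v outflow m v).
  have out0 v : outflow m v = 0.
    by apply/eqP; move/eqP: tot0; rewrite sum_nat_eq0 => /forallP/(_ v).
  suff -> : C = C' by exact: rt1n_refl.
  apply/ffunP => v; have := bal v; rewrite out0 /inflow big1; first by lia.
  by move=> u _; have := leq_outflow m u v; rewrite out0; lia.
have C'r : 0 < C' r by rewrite supp.
have [v Cv outv] := flow_progress bal C'r drain tot_gt0.
(* Prefer a move away from the root, so that a move to the parent is made only
   when all moves still planned at v go there. *)
have [x mvx only] : exists2 x, 0 < m v x &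
    x = parent v -> forall y, y != x -> m v y = 0.
  have [/existsP [x /andP [xp mvx]]|/existsPn none] :=
      boolP [exists x, (x != parent v) && (0 < m v x)].
    by exists x => // xpE; rewrite xpE eqxx in xp.
  have none' y : y != parent v -> m v y = 0 by have := none y; lia.
  exists (parent v) => //; move: outv.
  by rewrite /outflow (bigD1 (parent v)) //= big1 ?addn0.
have lvx : legal_move e C v x by rewrite /legal_move me.
pose m1 a b := m a b - ((a == v) && (b == x)).
have mE a b : m a b = add_move m1 v x a b.
  rewrite /add_move /m1; case: eqP => [->|_]; last by rewrite /= subn0 addn0.
  by case: eqP => [->|_]; rewrite /= ?subn0 ?addn0 ?subnK.
have inE1 w : inflow m w = inflow m1 w + (w == x).
  by rewrite -(inflow_add m1 v x w); apply: eq_bigr => u _; rewrite mE.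
have outE1 w : outflow m w = outflow m1 w + (w == v).
  by rewrite -(outflow_add m1 v x w); apply: eq_bigr => u _; rewrite mE.
have me1 : on_edges m1 by move=> a b ?; apply: me; rewrite mE ltn_addr.
have bal1 : balanced m1 (do_move C v x) C'.
  apply/balanced_add => // w; rewrite inflow_add outflow_add -inE1 -outE1.
  exact: bal.
apply: rt1n_trans (IH m1 _ me1 bal1 _ _); first by exists v, x.
- move=> w wr gt0.
  have := drain w wr; have := mE w (parent w); have := bal1 w.
  have := do_moveE w lvx; have := inE1 w; have := leq_inflow m v x.
  rewrite /add_move; have [wv|wv] := eqVneq w v; last by case: eqP => [->|_]; lia.
  have [px|px] := eqVneq (parent w) x; last by lia.
  (* If this was the last move planned at w = v, the balance with final value 0
     leaves w empty with nothing due, so the invariant asks for nothing. *)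
  have C'w : C' w = 0 by have := supp w; rewrite (negPf wr); lia.
  have out1 : outflow m1 w = m1 w x.
    rewrite /outflow (bigD1 x) //= big1 ?addn0 // => y yx.
    by rewrite /m1 wv only // -wv.
  by rewrite px out1 C'w; lia.
- suff : \sum_v outflow m v = (\sum_v outflow m1 v).+1 by lia.
  rewrite (eq_bigr _ (fun w _ => outE1 w)) big_split /= -addn1; congr (_ + _).
  by rewrite (bigD1 v) //= eqxx big1 // => w /negPf ->.
Qed.

Local Open Scope ring_scope.

(** The optimal flow towards r: exits moves up each edge below which the branch is
    occupied, and as many moves down as the weight falls short of 2 * exits. *)
Definition plan C u v : nat :=
  if ~~ e u v then 0%N
  else if r \in branch e v u then
    if occupied e C u v then exits (weight C u v) else 0%N
  else if occupied e C v u then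
    `|(2 * (exits (weight C v u))%:Z - weight C v u)%R|%N else 0%N.

Lemma plan_up C u v : e u v -> r \in branch e v u ->
  plan C u v = if occupied e C u v then exits (weight C u v) else 0%N.
Proof. by move=> euv rv; rewrite /plan euv rv. Qed.

(** The first amount is what the parent receives, the second what the child
    does: exactly what cancels its weight. *)
Lemma net_plan_up C u v : e u v -> r \in branch e v u ->
  net (plan C) u v = message_bar e C u v /\ net (plan C) v u = - weight C u v.
Proof.
move=> euv rv; rewrite /net plan_up // message_barE //.
rewrite /plan [e v u]e_sym euv (branch_disj _ rv) 1?e_sym //=.
case: ifPn => [_|nocc]; last by rewrite weight_empty.
by rewrite F_exits; have := exits_ge (weight C u v); lia.
Qed.

Lemma plan_balanced C : 0 < score e C r ->
  balanced (plan C) C [ffun v => if v == r then `|score e C r|%N else 0%N].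
Proof.
move=> score_gt0; apply/balanced_net.
  by move=> u v; rewrite /plan; case: (e u v).
move=> v; rewrite ffunE; have [->|vr] := eqVneq v r.
  rewrite gtz0_abs // /score; congr (_ + _); apply: eq_bigr => u eur.
  by have [->] := net_plan_up C eur (branch_self _ _ _).
have /andP [evp rp] := parentP vr.
rewrite (bigD1 (parent v)) 1?e_sym //=; have [_ ->] := net_plan_up C evp rp.
rewrite (eq_bigr (fun u => message_bar e C u v)); first by rewrite addrCA addNr.
move=> u /andP [euv up].
by have [->] := net_plan_up C euv (root_beyond euv evp rp up).
Qed.

Lemma score_gt0_stackable C : 0 < score e C r -> stackable_at e C r.
Proof.
move=> score_gt0.
have stacked : stacked_at
    ([ffun v => if v == r then `|score e C r|%N else 0%N] : config T) r.
  by apply/setP => v; rewrite !inE ffunE; case: eqP => // _; lia.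
eexists; last exact: stacked.
apply: flow_reachable (plan_balanced score_gt0) stacked _.
  by move=> u v; rewrite /plan; case: (e u v).
move=> v vr gt0; have /andP [evp rp] := parentP vr.
suff occ : occupied e C v (parent v) by rewrite plan_up // occ exits_gt0.
have [Cv0|] := eqVneq (C v) 0%N; last exact: occupied_self.
move: gt0; rewrite Cv0 add0n /inflow lt0n sum_nat_eq0 => /forallPn [u].
have [euv|neuv] := boolP (e u v); last by rewrite /plan neuv.
have [up|up] := eqVneq u (parent v).
  rewrite up /plan [e _ v]e_sym evp (branch_disj _ rp) 1?e_sym //=.
  by case: ifP.
rewrite plan_up ?(root_beyond euv evp) //.
by case: ifP => // occ _; apply: occupied_parent occ.
Qed.

End Rooted.
End Branches.

Theorem theorem3p3 (T : finType) (e : rel T) (hT : is_tree e)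
    (hcard : (2 <= #|T|)%N) :
  (forall (C : config T) (r : T),
      stackable_at e C r <-> (0 < score e C r)%R)
  /\ (forall C : config T,
      nonstackable e C <-> (forall v : T, (score e C v <= 0)%R)).
Proof.
have iff C r : stackable_at e C r <-> (0 < score e C r)%R.
  by split; [apply: stackable_score_gt0 | apply: score_gt0_stackable].
split=> // C; split=> [nst v | le0 [r /iff]]; last by rewrite ltNge le0.
by rewrite leNgt; apply/negP => /iff st; case: nst; exists v.
Qed.
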